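(* Let $\xi$ be a smooth unit vector field on a 2-dimensional Riemannian manifold $M$. Let $e_0$ be a unit vector field on $M$ such that $\nabla_{e_0}\xi=0$, and let $\eta$ and $e_1$ be unit vector fields on $M$ such that $(\xi,\eta)$ and $(e_0,e_1)$ form two orthonormal frames on $M$. Let $\lambda$ be the signed singular value of the operator $\nabla\xi$ (with respect to the singular frame $(e_0,e_1;\eta)$). Then $$\nabla_{e_1}\xi=\lambda\eta,$$ and the following relations hold: (a) if $k=\langle\nabla_\xi\xi,\eta\rangle$ is the signed geodesic curvature of the $\xi$-curves and $\kappa=\langle\nabla_\eta\eta,\xi\rangle$ is the signed geodesic curvature of the $\eta$-curves, then $$\lambda^2=k^2+\kappa^2;$$ (b) if $K$ is the Gaussian curvature of $M$, then $$(-1)^sK=e_0(\lambda)-\lambda\sigma,$$ where $\sigma=\langle\nabla_{e_1}e_1,e_0\rangle$ is the signed geodesic curvature of the $e_1$-curves, and $s=1$ if the frames $(\xi,\eta)$ and $(e_0,e_1)$ have the same orientation, $s=0$ if they have opposite orientations.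
   Context: $\nabla$ is the Levi-Civita connection of $M$, and $\langle\cdot,\cdot\rangle$ its metric. For a unit vector field $\xi$, the operator $\nabla\xi:T_pM\to\xi_p^\perp$ is $(\nabla\xi)X=\nabla_X\xi$, with adjoint $(\nabla\xi)^*:\xi_p^\perp\to T_pM$. In dimension 2, an orthonormal frame $(e_0,e_1)$ of $T_pM$ together with a unit vector $f_1\in\xi_p^\perp$ is a singular frame with signed singular value $\lambda\in\mathbb R$ if $(\nabla\xi)e_0=0$, $(\nabla\xi)e_1=\lambda f_1$, $(\nabla\xi)^*f_1=\lambda e_1$; the sign of $\lambda$ depends on the directions chosen for the frame vectors. All fields are smooth, and $e_0(\lambda)$ denotes the derivative of $\lambda$ along $e_0$. *)

(* Defs.v *)
From mathcomp Require Import all_boot all_order all_algebra.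
From mathcomp Require Import all_classical all_reals all_analysis.

Set Implicit Arguments.
Unset Strict Implicit.
Unset Printing Implicit Defensive.

Import Order.TTheory GRing.Theory Num.Theory numFieldNormedType.Exports.
Local Open Scope classical_set_scope.
Local Open Scope ring_scope.

Fixpoint ndifferentiable_on (R : realType) (n : nat) (V : normedModType R)
    (k : nat) (U : set 'rV[R]_n) (f : 'rV[R]_n -> V) : Prop :=
  if k is k'.+1 then
    (forall x, U x -> differentiable f x) /\
    (forall v, ndifferentiable_on k' U (fun x => 'D_v f x))
  else True.

(* C^oo on U.  Continuity of the partial derivatives of order k follows from
   their differentiability at order k+1. *)
Definition smooth_on (R : realType) (n : nat) (V : normedModType R)
    (U : set 'rV[R]_n) (f : 'rV[R]_n -> V) : Prop :=
  forall k, ndifferentiable_on k U f.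

(* [phi c] and [psi c] are total functions, meaningful only on [dom c] and on
   [phi c @` dom c] respectively, where they are inverse homeomorphisms. *)
Record smoothManifold (R : realType) (n : nat) := SmoothManifold {
  carrier :> topologicalType;
  manifold_hausdorff : hausdorff_space carrier;
  manifold_second_countable : @second_countable carrier;
  chart : Type;
  dom : chart -> set carrier;
  phi : chart -> carrier -> 'rV[R]_n;
  psi : chart -> 'rV[R]_n -> carrier;
  chart_at : carrier -> chart;
  chart_atP : forall p, dom (chart_at p) p;
  open_dom : forall c, open (dom c);
  open_cod : forall c, open (phi c @` dom c);
  phiK : forall c p, dom c p -> psi c (phi c p) = p;
  phi_continuous : forall c p, dom c p -> {for p, continuous (phi c)};
  psi_continuous : forall c x, (phi c @` dom c) x -> {for x, continuous (psi c)};
  transition_smooth : forall c d,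
    smooth_on (phi c @` (dom c `&` dom d)) (phi d \o psi c) }.

(* The tangent space at p is identified with R^n by means of the distinguished
   chart [chart_at p]: v : 'rV[R]_n stands for the tangent vector at p whose
   components in that chart are v.  In particular a vector field is an arbitrary
   function on M, and components with respect to other charts are obtained from
   the differentials of the transition maps ([tpush], [components]). *)
Definition vfield (R : realType) (n : nat) (M : smoothManifold R n) :=
  M -> 'rV[R]_n.

Section Manifold.
Variables (R : realType) (n : nat) (M : smoothManifold R n).
Implicit Types (p : M) (c : chart M) (X Y : vfield M).

(* The derivative v(F) of F along the tangent vector v at p. *)
Definition tderiv (V : normedModType R) (F : M -> V) p (v : 'rV[R]_n) : V :=
  'D_v (F \o psi (chart_at p)) (phi (chart_at p) p).

Definition components c X p : 'rV[R]_n := tderiv (phi c) p (X p).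

(* The tangent vector at p whose components in the chart c are w. *)
Definition tpush c p (w : 'rV[R]_n) : 'rV[R]_n :=
  'D_w (phi (chart_at p) \o psi c) (phi c p).

Definition smooth_fun (V : normedModType R) (F : M -> V) : Prop :=
  forall c, smooth_on (phi c @` dom c) (F \o psi c).

Definition smooth_vfield X : Prop :=
  forall c, smooth_on (phi c @` dom c) (components c X \o psi c).

(* [X, Y]^j = X(Y^j) - Y(X^j) in the chart distinguished at p. *)
Definition lie X Y p : 'rV[R]_n :=
  let c := chart_at p in
  tderiv (components c Y) p (X p) - tderiv (components c X) p (Y p).

Record riemannianMetric := RiemannianMetric {
  metric :> M -> 'rV[R]_n -> 'rV[R]_n -> R;
  metricDl : forall p a u v w,
    metric p (a *: u + v) w = a * metric p u w + metric p v w;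
  metricC : forall p u v, metric p u v = metric p v u;
  metric_gt0 : forall p v, v != 0 -> 0 < metric p v v;
  metric_smooth : forall c (i j : 'I_n),
    smooth_on (phi c @` dom c)
      (fun x => let p := psi c x in
         metric p (tpush c p (delta_mx 0 i)) (tpush c p (delta_mx 0 j))) }.

(* [nabla p v Y] is the covariant derivative at p of the field Y along the
   tangent vector v at p; its value is irrelevant when Y is not smooth. *)
Record leviCivita (g : riemannianMetric) := LeviCivita {
  nabla :> forall p, 'rV[R]_n -> vfield M -> 'rV[R]_n;
  nablaDl : forall p a u v Y, smooth_vfield Y ->
    nabla p (a *: u + v) Y = a *: nabla p u Y + nabla p v Y;
  nablaDr : forall p v Y Z, smooth_vfield Y -> smooth_vfield Z ->
    nabla p v (fun q => Y q + Z q) = nabla p v Y + nabla p v Z;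
  nabla_leibniz : forall p v (f : M -> R) Y, smooth_fun f -> smooth_vfield Y ->
    nabla p v (fun q => f q *: Y q)
      = tderiv f p v *: Y p + f p *: nabla p v Y;
  nabla_smooth : forall X Y, smooth_vfield X -> smooth_vfield Y ->
    smooth_vfield (fun p => nabla p (X p) Y);
  nabla_metric : forall p v Y Z, smooth_vfield Y -> smooth_vfield Z ->
    tderiv (fun q => g q (Y q) (Z q)) p v
      = g p (nabla p v Y) (Z p) + g p (Y p) (nabla p v Z);
  nabla_torsion : forall p X Y, smooth_vfield X -> smooth_vfield Y ->
    nabla p (X p) Y - nabla p (Y p) X = lie X Y p }.

Section Riemannian.
Variables (g : riemannianMetric) (D : leviCivita g).

(* The field "nabla_X Y". *)
Definition cov X Y : vfield M := fun p => D p (X p) Y.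

Definition riemann X Y Z : vfield M := fun p =>
  cov X (cov Y Z) p - cov Y (cov X Z) p - cov (lie X Y) Z p.

Definition sectional X Y p : R :=
  g p (riemann X Y Y p) (X p)
    / (g p (X p) (X p) * g p (Y p) (Y p) - g p (X p) (Y p) ^+ 2).

(* Meant for n = 2, where the only tangent plane at p is T_pM.  The Gram
   determinant is nonzero iff X and Y are linearly independent at p. *)
Definition gaussian_curvature (K : M -> R) : Prop :=
  forall p X Y, smooth_vfield X -> smooth_vfield Y ->
    g p (X p) (X p) * g p (Y p) (Y p) - g p (X p) (Y p) ^+ 2 != 0 ->
    K p = sectional X Y p.

Definition orthonormal_pair p (u v : 'rV[R]_n) : Prop :=
  [/\ g p u u = 1, g p v v = 1 & g p u v = 0].

(* The adjoint of A for the metric at p; it exists and is unique when A is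
   linear. *)
Definition adjoint p (A : 'rV[R]_n -> 'rV[R]_n) (w : 'rV[R]_n) : 'rV[R]_n :=
  get [set u | forall v, g p (A v) w = g p v u].

(* (e0, e1; f1) is a singular frame of (nabla xi)_p : T_pM -> xi_p^\perp, with
   signed singular value lam. *)
Definition singular_frame (xi : vfield M) p (e0 e1 f1 : 'rV[R]_n) (lam : R) :
    Prop :=
  let A v := D p v xi in
  [/\ orthonormal_pair p e0 e1, g p f1 f1 = 1 /\ g p f1 (xi p) = 0,
      A e0 = 0, A e1 = lam *: f1 & adjoint p A f1 = lam *: e1].

End Riemannian.
End Manifold.

(* Both determinants are taken with respect to the same basis of T_pM. *)
Definition same_orientation (R : realType) (M : smoothManifold R 2)
    (X Y X' Y' : vfield M) (p : M) : bool :=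
  0 < \det (col_mx (X p) (Y p) : 'M[R]_2)
      * \det (col_mx (X' p) (Y' p) : 'M[R]_2).

(* Main.v *)
Require Import Defs.
From mathcomp Require Import all_boot all_order all_algebra.
From mathcomp Require Import all_classical all_reals all_analysis.
From mathcomp Require Import ring lra.
Import Order.TTheory GRing.Theory Num.Theory numFieldNormedType.Exports.
Local Open Scope classical_set_scope.
Local Open Scope ring_scope.

Set Implicit Arguments.
Unset Strict Implicit.
Unset Printing Implicit Defensive.

(** Write a = <xi, e1>, b = <eta, e1>, a0 = <xi, e0>, b0 = <eta, e0>.  As xi is
    a unit field, every derivative of xi is a multiple of eta; as the derivative
    along e0 vanishes, [nabla_xi] says that D_v xi = lam <v, e1> eta with
    lam = <D_e1 xi, eta>.  Everything follows from this formula.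

    For (a): k = lam a, and kappa = - <D_eta xi, eta> = - lam b because xi and
    eta stay orthogonal, while a^2 + b^2 = |e1|^2 = 1.

    For (b), the curvature is K = <R(eta, xi) xi, eta>.  The two fields
    D_xi xi = lam a eta and D_eta xi = lam b eta are explicit, and <D_v eta, eta>
    vanishes, so
      K = eta(lam a) - xi(lam b) - lam <[eta, xi], e1>.
    The product rule, metric compatibility and the absence of torsion leave only
    derivatives of lam and the connection form v |-> <D_v e1, e0>; expanding xi,
    eta and the vectors at which these linear forms are taken in the frame
    (e0, e1) gives
      K = (a b0 - a0 b) (e0(lam) - lam sigma).
    The first factor is minus the determinant of the change of orthonormal
    frames, hence - 1 or 1 according to the orientations ([same_orientationP]).

    The product rule requires lam, a and b to be differentiable.  A tangent
    vector at p is given by its components in one chart chosen at p, whereas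
    smoothness is tested in all charts, so [smooth_metric], the smoothness of
    <X, Y> for smooth fields X and Y, rests on [tpush_tderiv]: passing to the
    components in another chart and back is the identity, by the chain rule
    applied to the transition maps. *)

(** * Smooth functions on open subsets of R^n *)

Section SmoothCalculus.
Variables (R : realType) (n : nat).
Implicit Type U : set 'rV[R]_n.

Lemma differentiable_near_eq (V W : normedModType R) (f h : V -> W) x :
  {near x, f =1 h} -> differentiable f x -> differentiable h x.
Proof.
move=> fh df; have fhx : f x = h x := nbhs_singleton fh.
(* The first-order expansion of f at x is also one of h. *)
have hE : h \o shift x = cst (h x) + 'd f x +o_ 0 id.
  have /eqaddoP fE := diff_locally df.
  move: fh; rewrite (near_shift 0 x) subr0 => fh.
  apply/eqaddoP => e /fE; apply: filterS2 fh => y /= fhy.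
  by rewrite !fctE /= -fhx -fhy.
have dE : 'd h x = 'd f x :> (V -> W).
  exact: diff_unique (diff_continuous df) hE.
by apply/diff_locallyP; rewrite dE; split => //; exact: diff_continuous df.
Qed.

(** Openness of [U] is what lets pointwise equality on [U] pass to directional
    derivatives.  The sum, product and coordinate rules below rely on it, since
    the formulas for the derivatives hold on [U] only. *)
Lemma ndifferentiable_on_eq (V : normedModType R) k U (f h : 'rV[R]_n -> V) :
  open U -> (forall x, U x -> f x = h x) ->
  ndifferentiable_on k U f -> ndifferentiable_on k U h.
Proof.
move=> oU; elim: k f h => [//|k IH] f h fh [df Df].
have fhn x : U x -> {near x, f =1 h}.
  by move=> Ux; apply: filterS (open_nbhs_nbhs (conj oU Ux)) => y; exact: fh.
split=> [x Ux|v]; first exact: differentiable_near_eq (fhn x Ux) (df x Ux).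
by apply: IH (Df v) => x Ux; exact: near_eq_derive (fhn x Ux).
Qed.

Lemma ndifferentiable_onW (V : normedModType R) k U (f : 'rV[R]_n -> V) :
  ndifferentiable_on k.+1 U f -> ndifferentiable_on k U f.
Proof.
elim: k f => [//|k IH] f [df Df]; split=> // v; exact/IH/Df.
Qed.

Lemma ndifferentiable_onD (V : normedModType R) k U (f h : 'rV[R]_n -> V) :
  open U -> ndifferentiable_on k U f -> ndifferentiable_on k U h ->
  ndifferentiable_on k U (fun x => f x + h x).
Proof.
move=> oU; elim: k f h => [//|k IH] f h [df Df] [dh Dh].
split=> [x Ux|v]; first exact: differentiableD (df x Ux) (dh x Ux).
apply: (ndifferentiable_on_eq oU _ (IH _ _ (Df v) (Dh v))) => x Ux.
by rewrite -deriveD //; apply: diff_derivable; [exact: df | exact: dh].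
Qed.

Lemma ndifferentiable_onM k U (f h : 'rV[R]_n -> R) :
  open U -> ndifferentiable_on k U f -> ndifferentiable_on k U h ->
  ndifferentiable_on k U (fun x => f x * h x).
Proof.
move=> oU; elim: k f h => [//|k IH] f h sf sh.
have [[df Df] [dh Dh]] := (sf, sh).
split=> [x Ux|v]; first exact: differentiableM (df x Ux) (dh x Ux).
have sf' := ndifferentiable_onW sf; have sh' := ndifferentiable_onW sh.
apply: (ndifferentiable_on_eq oU _
  (ndifferentiable_onD oU (IH _ _ sf' (Dh v)) (IH _ _ sh' (Df v)))) => x Ux.
by rewrite [RHS]deriveM //; apply: diff_derivable; [exact: df | exact: dh].
Qed.

Lemma smooth_on_eq (V : normedModType R) U (f h : 'rV[R]_n -> V) :
  open U -> (forall x, U x -> f x = h x) -> smooth_on U f -> smooth_on U h.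
Proof. by move=> oU fh sf k; exact: ndifferentiable_on_eq oU fh (sf k). Qed.

Lemma smooth_on_differentiable (V : normedModType R) U (f : 'rV[R]_n -> V) x :
  smooth_on U f -> U x -> differentiable f x.
Proof. by move=> sf Ux; have [df _] := sf 1%N; exact: df. Qed.

Lemma smooth_on_cst (V : normedModType R) U (a : V) :
  open U -> smooth_on U (fun=> a : V).
Proof.
move=> oU k; elim: k a => [//|k IH] a; split=> [x _|v].
  exact: differentiable_cst.
by apply: (ndifferentiable_on_eq oU _ (IH 0)) => x _; rewrite derive_cst.
Qed.

Lemma smooth_onM U (f h : 'rV[R]_n -> R) : open U ->
  smooth_on U f -> smooth_on U h -> smooth_on U (fun x => f x * h x).
Proof. by move=> oU sf sh k; exact: ndifferentiable_onM oU (sf k) (sh k). Qed.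

Lemma smooth_on_sum (I : Type) (r : seq I) (V : normedModType R) U
    (f : I -> 'rV[R]_n -> V) : open U ->
  (forall i, smooth_on U (f i)) -> smooth_on U (fun x => \sum_(i <- r) f i x).
Proof.
move=> oU sf; elim: r => [|i r IH].
  by apply: (smooth_on_eq oU _ (smooth_on_cst 0 oU)) => x _; rewrite big_nil.
apply: (@smooth_on_eq _ _ (fun x => f i x + \sum_(j <- r) f j x)) => //.
  by move=> x _; rewrite big_cons.
by move=> k; exact: ndifferentiable_onD oU (sf i k) (IH k).
Qed.

Lemma smooth_on_coord m U (f : 'rV[R]_n -> 'rV[R]_m) i : open U ->
  smooth_on U f -> smooth_on U (fun x => f x 0 i).
Proof.
move=> oU sf k; have := sf k; elim: k f {sf} => [//|k IH] f [df Df].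
split=> [x Ux|v].
  exact: differentiable_comp (df x Ux) (differentiable_coord (f x) 0 i).
apply: (ndifferentiable_on_eq oU _ (IH _ (Df v))) => x Ux.
by rewrite derive_mx ?mxE //; apply: diff_derivable; exact: df.
Qed.

End SmoothCalculus.

(** * Tangent vectors and derivatives of functions *)

Lemma derive_left_inverse (R : realType) (V W : normedModType R)
    (F : V -> W) (G : W -> V) x v :
  differentiable F x -> differentiable G (F x) -> {near x, cancel F G} ->
  'D_('D_v F x) G (F x) = v.
Proof.
move=> dF dG FK; have dGF : differentiable (G \o F) x.
  exact: differentiable_comp.
rewrite (deriveE _ dG) (deriveE _ dF) -[LHS]/(('d G (F x) \o 'd F x) v).
rewrite -diff_comp // -deriveE // -[RHS](derive_id x v).
exact: near_eq_derive.
Qed.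

Section TangentVectors.
Variables (R : realType) (n : nat) (M : smoothManifold R n).
Implicit Types (p : M) (c d : chart M) (v w : 'rV[R]_n).

Lemma differentiable_transition c d p : dom c p -> dom d p ->
  differentiable (phi d \o psi c) (phi c p).
Proof.
move=> cp dp; apply: smooth_on_differentiable (transition_smooth c d) _.
by exists p.
Qed.

(** The differentials of the two transition maps between [chart_at p] and [c]
    are mutually inverse. *)
Lemma tpush_tderiv c p v : dom c p -> tpush c p (tderiv (phi c) p v) = v.
Proof.
move=> cp; rewrite /tpush /tderiv; set d := chart_at p.
have dp : dom d p := chart_atP p.
have dF := differentiable_transition dp cp.
have dG := differentiable_transition cp dp.
have := @derive_left_inverse _ _ _ _ (phi d \o psi c) _ v dF.
have -> : (phi c \o psi d) (phi d p) = phi c p by rewrite /= phiK.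
apply => //.
have dx : (phi d @` dom d) (phi d p) by exists p.
have ncp : nbhs p (dom c).
  exact: open_nbhs_nbhs (conj (@open_dom _ _ M c) cp).
have ndom : \forall y \near phi d p, dom c (psi d y).
  have /(_ (dom c)) := psi_continuous dx; rewrite phiK //; exact.
have ncod : nbhs (phi d p) (phi d @` dom d).
  exact: open_nbhs_nbhs (conj (@open_cod _ _ M d) dx).
apply: filterS2 ndom ncod => y + [q dq qy] /=.
by rewrite -qy phiK // => cq; rewrite phiK.
Qed.

Lemma tpush_coord c p w : dom c p ->
  tpush c p w = \sum_i w 0 i *: tpush c p (delta_mx 0 i).
Proof.
move=> cp; have dG := differentiable_transition cp (chart_atP p).
rewrite {1}[w]row_sum_delta /tpush deriveE // linear_sum.
by apply: eq_bigr => i _; rewrite linearZ deriveE.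
Qed.

Lemma smooth_fun_differentiable (V : normedModType R) (F : M -> V) p :
  smooth_fun F -> differentiable (F \o psi (chart_at p)) (phi (chart_at p) p).
Proof.
move=> sF; apply: smooth_on_differentiable (sF (chart_at p)) _.
by exists p => //; exact: chart_atP.
Qed.

Lemma tderiv_lin (V : normedModType R) (F : M -> V) p a b v w :
  smooth_fun F ->
  tderiv F p (a *: v + b *: w) = a *: tderiv F p v + b *: tderiv F p w.
Proof.
move=> /(smooth_fun_differentiable p) dF.
by rewrite /tderiv !deriveE // linearD !linearZ.
Qed.

Lemma tderivM (F G : M -> R) p v : smooth_fun F -> smooth_fun G ->
  tderiv (fun q => F q * G q) p v = tderiv F p v * G p + F p * tderiv G p v.
Proof.
move=> /(smooth_fun_differentiable p) dF /(smooth_fun_differentiable p) dG.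
have pK := phiK (chart_atP p).
rewrite /tderiv [LHS](deriveM (diff_derivable dF) (diff_derivable dG)).
by rewrite [LHS]addrC; congr (_ + _); rewrite /GRing.scale /= pK // mulrC.
Qed.

Lemma smooth_funM (F G : M -> R) :
  smooth_fun F -> smooth_fun G -> smooth_fun (fun q => F q * G q).
Proof.
by move=> sF sG c; exact: smooth_onM (@open_cod _ _ M c) (sF c) (sG c).
Qed.

Lemma tderiv_cst (V : normedModType R) (a : V) p v :
  tderiv (fun=> a) p v = 0.
Proof. exact: derive_cst. Qed.

End TangentVectors.

(** * Smoothness of inner products *)

Section Metric.
Variables (R : realType) (n : nat) (M : smoothManifold R n).
Variable g : riemannianMetric M.
Implicit Types (p : M) (u v w : 'rV[R]_n).

Lemma metric0l p w : g p 0 w = 0.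
Proof.
apply: (addIr (g p 0 w)).
by rewrite add0r -{1}[g p 0 w]mul1r -metricDl scaler0 addr0.
Qed.

Lemma metricZl p a u w : g p (a *: u) w = a * g p u w.
Proof. by rewrite -[a *: u]addr0 metricDl metric0l addr0. Qed.

Lemma metric_addl p u v w : g p (u + v) w = g p u w + g p v w.
Proof. by rewrite -{1}[u]scale1r metricDl mul1r. Qed.

Lemma metricBl p u v w : g p (u - v) w = g p u w - g p v w.
Proof. by rewrite -scaleN1r addrC metricDl mulN1r addrC. Qed.

Lemma metric_suml p I (r : seq I) (F : I -> 'rV[R]_n) w :
  g p (\sum_(i <- r) F i) w = \sum_(i <- r) g p (F i) w.
Proof.
apply: (big_morph (fun v => g p v w)) => [u v|]; last exact: metric0l.
exact: metric_addl.
Qed.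

Lemma metric_eq p u v : (forall w, g p w u = g p w v) -> u = v.
Proof.
move=> uv; apply/eqP; rewrite -subr_eq0; apply: contraT => /(metric_gt0 g p).
by rewrite metricBl [g p u _]metricC [g p v _]metricC uv subrr ltxx.
Qed.

Lemma metric_bilinear_sum p (I : finType) (v w : I -> R) (e : I -> 'rV[R]_n) :
  g p (\sum_i v i *: e i) (\sum_j w j *: e j)
    = \sum_i \sum_j v i * w j * g p (e i) (e j).
Proof.
rewrite metric_suml; apply: eq_bigr => i _.
rewrite metricZl metricC metric_suml mulr_sumr.
by apply: eq_bigr => j _; rewrite metricZl mulrA metricC.
Qed.

Lemma metric_tpush c p v w : dom c p ->
  g p (tpush c p v) (tpush c p w)
    = \sum_i \sum_j v 0 i * w 0 j
        * g p (tpush c p (delta_mx 0 i)) (tpush c p (delta_mx 0 j)).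
Proof.
move=> cp; rewrite (tpush_coord v cp) (tpush_coord w cp).
exact: metric_bilinear_sum.
Qed.

(** In the chart [c], <X, Y> is the sum of X^i Y^j g_ij. *)
Lemma smooth_metric (X Y : vfield M) : smooth_vfield X -> smooth_vfield Y ->
  smooth_fun (fun p => g p (X p) (Y p)).
Proof.
move=> sX sY c; have oU := @open_cod _ _ M c.
have sXi i := smooth_on_coord i oU (sX c).
have sYi i := smooth_on_coord i oU (sY c).
have sum_smooth := smooth_on_sum _ oU (fun i => smooth_on_sum _ oU (fun j =>
  smooth_onM oU (smooth_onM oU (sXi i) (sYi j)) (metric_smooth g c i j))).
apply: smooth_on_eq oU _ (sum_smooth (index_enum _) (index_enum _)).
move=> _ [p cp <-] /=; rewrite phiK //.
rewrite -metric_tpush //; congr (g p _ _); exact: tpush_tderiv.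
Qed.

End Metric.

(** * Orthonormal frames of a tangent plane *)

Lemma det_mx22 (R : comNzRingType) (A : 'M[R]_2) :
  \det A = A 0 0 * A 1 1 - A 0 1 * A 1 0.
Proof.
rewrite (expand_det_row _ 0) !big_ord_recl big_ord0 addr0 /cofactor !det_mx11.
rewrite !mxE /= !expr0 expr1 mul1r mulN1r mulrN.
by congr (A _ _ * A _ _ - A _ _ * A _ _); exact/val_inj.
Qed.

Section Plane.
Variables (R : realType) (M : smoothManifold R 2) (g : riemannianMetric M).
Implicit Types (p : M) (u v w : 'rV[R]_2).

Lemma det_rows u v :
  \det (col_mx u v : 'M[R]_2) = u 0 0 * v 0 1 - u 0 1 * v 0 0.
Proof.
have r0 j : (col_mx u v : 'M[R]_2) 0 j = u 0 j.
  by rewrite -(col_mxEu u v 0 j); congr (col_mx u v _ _); exact/val_inj.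
have r1 j : (col_mx u v : 'M[R]_2) 1 j = v 0 j.
  by rewrite -(col_mxEd u v 0 j); congr (col_mx u v _ _); exact/val_inj.
by rewrite det_mx22 !r0 !r1.
Qed.

Lemma mul_row_rows (r u v : 'rV[R]_2) :
  r *m (col_mx u v : 'M[R]_2) = r 0 0 *: u + r 0 1 *: v.
Proof.
rewrite -[in LHS](@hsubmxK _ 1 1 1 r) (@mul_row_col _ 1 1 1 2).
rewrite [lsubmx _]mx11_scalar [rsubmx _]mx11_scalar !mul_scalar_mx !mxE.
by congr (r _ _ *: _ + r _ _ *: _); exact/val_inj.
Qed.

Lemma orthonormal_unitmx p u v : orthonormal_pair g p u v ->
  (col_mx u v : 'M[R]_2) \in unitmx.
Proof.
move=> [uu vv uv]; rewrite -row_free_unit; apply: inj_row_free => r.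
rewrite mul_row_rows => r0.
have r00 : r 0 0 = 0.
  have := metric0l g p u.
  by rewrite -r0 metric_addl !metricZl uu [g p v u]metricC uv mulr1 mulr0 addr0.
have r01 : r 0 1 = 0.
  have := metric0l g p v.
  by rewrite -r0 metric_addl !metricZl vv uv mulr1 mulr0 add0r.
apply/rowP => -[[|[|//]] ?]; rewrite mxE; [rewrite -[RHS]r00|rewrite -[RHS]r01].
  by congr (r 0 _); exact/val_inj.
by congr (r 0 _); exact/val_inj.
Qed.

Lemma orthonormal_expand p u v w : orthonormal_pair g p u v ->
  w = g p w u *: u + g p w v *: v.
Proof.
move=> uvP; have [uu vv uv] := uvP.
rewrite -(mulmxKV (orthonormal_unitmx uvP) w).
set r := w *m _; rewrite mul_row_rows !metric_addl !metricZl.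
by rewrite uu vv uv [g p v u]metricC uv !mulr1 !mulr0 addr0 add0r.
Qed.

Lemma metric_orthonormal p u v w z : orthonormal_pair g p u v ->
  g p w z = g p w u * g p z u + g p w v * g p z v.
Proof.
move=> uvP; rewrite {1}(orthonormal_expand w uvP) metric_addl !metricZl.
by rewrite ![g p _ z]metricC.
Qed.

(** The left-hand side is the determinant of the change of frame.  Its square is
    1 by orthonormality of the two frames, and its sign is that of the product of
    determinants defining [same_orientation], which differs from it by the factor
    (det (E, F))^2 > 0. *)
Lemma same_orientationP (X Y E F : vfield M) p :
  orthonormal_pair g p (X p) (Y p) -> orthonormal_pair g p (E p) (F p) ->
  g p (X p) (E p) * g p (Y p) (F p) - g p (X p) (F p) * g p (Y p) (E p)
    = (-1) ^+ (~~ same_orientation X Y E F p).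
Proof.
move=> XY EF; set a0 := g p (X p) (E p); set a := g p (X p) (F p).
set b0 := g p (Y p) (E p); set b := g p (Y p) (F p).
set d := \det (col_mx (E p) (F p) : 'M[R]_2).
have dXY : \det (col_mx (X p) (Y p) : 'M[R]_2) = (a0 * b - a * b0) * d.
  rewrite /d !det_rows (orthonormal_expand (X p) EF).
  rewrite (orthonormal_expand (Y p) EF) -/a0 -/a -/b0 -/b !mxE; ring.
have d2 : 0 < d * d.
  have := orthonormal_unitmx EF; rewrite unitmxE unitfE -/d => d0.
  by rewrite -expr2 exprn_even_gt0.
have [XX YY XY0] := XY.
(* Lagrange's identity, |X|^2 |Y|^2 = <X, Y>^2 + (a0 b - a b0)^2. *)
have sq : (a0 * b - a * b0 - 1) * (a0 * b - a * b0 + 1) = 0.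
  have := metric_orthonormal (X p) (X p) EF.
  have := metric_orthonormal (Y p) (Y p) EF.
  have := metric_orthonormal (X p) (Y p) EF.
  rewrite XX YY XY0 -/a0 -/a -/b0 -/b => h0 h1 h2.
  suff -> : (a0 * b - a * b0 - 1) * (a0 * b - a * b0 + 1) =
    (a0 * a0 + a * a) * (b0 * b0 + b * b) - (a0 * b0 + a * b) ^+ 2 - 1.
    by rewrite -h0 -h1 -h2; ring.
  ring.
rewrite /same_orientation dXY -/d -mulrA pmulr_lgt0 //.
move/eqP: sq; rewrite mulf_eq0 subr_eq0 addr_eq0 => /orP[] /eqP ->.
  by rewrite ltr01.
by rewrite oppr_gt0 ltr10.
Qed.

End Plane.

(** * Covariant derivatives of unit fields *)

Section UnitField.
Variables (R : realType) (n : nat) (M : smoothManifold R n).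
Variables (g : riemannianMetric M) (D : leviCivita g).
Implicit Types (X Y Z : vfield M) (p : M) (v : 'rV[R]_n).

Lemma nabla_lin p a b u v X : smooth_vfield X ->
  D p (a *: u + b *: v) X = a *: D p u X + b *: D p v X.
Proof.
move=> sX; have D0 : D p 0 X = 0.
  apply: (addIr (D p 0 X)); rewrite add0r -[X in X + _]scale1r -nablaDl //.
  by rewrite scaler0 addr0.
rewrite nablaDl //; congr (_ + _).
by rewrite -[b *: v]addr0 nablaDl // D0 addr0.
Qed.

(** Derivative of the constant function <Y, Z>; it gives the skew-symmetry of the
    connection form of an orthonormal frame. *)
Lemma nabla_orthogonal p v Y Z (a : R) :
  smooth_vfield Y -> smooth_vfield Z -> (forall q, g q (Y q) (Z q) = a) ->
  g p (D p v Y) (Z p) = - g p (D p v Z) (Y p).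
Proof.
move=> sY sZ gYZ; have := nabla_metric D p v sY sZ.
have -> : (fun q => g q (Y q) (Z q)) = (fun=> a) by exact/funext.
rewrite tderiv_cst [g p (Y p) _]metricC => /esym/eqP.
by rewrite addr_eq0 => /eqP.
Qed.

Lemma nabla_unit p v Y : smooth_vfield Y -> (forall q, g q (Y q) (Y q) = 1) ->
  g p (D p v Y) (Y p) = 0.
Proof.
by move=> sY YY; have := nabla_orthogonal p v sY sY YY; lra.
Qed.

End UnitField.

(** * The singular value of nabla xi and the curvature *)

Section SurfaceFrames.
Variables (R : realType) (M : smoothManifold R 2).
Variables (g : riemannianMetric M) (D : leviCivita g).
Variables xi eta e0 e1 : vfield M.
Hypotheses (xi_smooth : smooth_vfield xi) (eta_smooth : smooth_vfield eta).
Hypothesis e1_smooth : smooth_vfield e1.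
Hypothesis xi_eta_frame : forall p, orthonormal_pair g p (xi p) (eta p).
Hypothesis e0_e1_frame : forall p, orthonormal_pair g p (e0 p) (e1 p).
Hypothesis cov_e0_xi : forall p, cov D e0 xi p = 0.
Implicit Types (p : M) (v : 'rV[R]_2).

Definition singular_value p : R := g p (cov D e1 xi p) (eta p).
Local Notation lam := singular_value.

Let xi1 p : g p (xi p) (xi p) = 1. Proof. by case: (xi_eta_frame p). Qed.
Let eta1 p : g p (eta p) (eta p) = 1. Proof. by case: (xi_eta_frame p). Qed.
Let e1e1 p : g p (e1 p) (e1 p) = 1. Proof. by case: (e0_e1_frame p). Qed.

Lemma singular_value_smooth : smooth_fun lam.
Proof.
exact: smooth_metric (nabla_smooth D e1_smooth xi_smooth) eta_smooth.
Qed.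

Lemma cov_e1_xi p : cov D e1 xi p = lam p *: eta p.
Proof.
rewrite [LHS](orthonormal_expand _ (xi_eta_frame p)).
by rewrite (nabla_unit D p _ xi_smooth xi1) scale0r add0r.
Qed.

(** At each point, nabla xi is the rank-one operator lam <., e1> eta. *)
Lemma nabla_xi p v : D p v xi = (lam p * g p v (e1 p)) *: eta p.
Proof.
rewrite {1}(orthonormal_expand v (e0_e1_frame p)) nabla_lin //.
have -> : D p (e0 p) xi = 0 := cov_e0_xi p.
have -> : D p (e1 p) xi = lam p *: eta p := cov_e1_xi p.
by rewrite scaler0 add0r scalerA mulrC.
Qed.

(** The adjoint of the operator lam <., e1> eta sends eta to lam e1. *)
Lemma singular_value_frame p :
  singular_frame D xi p (e0 p) (e1 p) (eta p) (lam p).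
Proof.
have [_ _ xe] := xi_eta_frame p.
split; [by []|by rewrite metricC xe|exact: cov_e0_xi|exact: cov_e1_xi|].
rewrite /adjoint; set S := (X in get X).
have Slam : S (lam p *: e1 p).
  move=> v; rewrite nabla_xi metricZl eta1 mulr1.
  by rewrite [RHS]metricC metricZl [g p (e1 p) v]metricC.
have Sget : S (get S) := getI Slam.
(* Any vector with the property defining the adjoint is lam e1. *)
by apply: (@metric_eq _ _ _ g p) => v; rewrite -Sget -Slam.
Qed.

Lemma singular_frame_value p (l : R) :
  singular_frame D xi p (e0 p) (e1 p) (eta p) l -> l = lam p.
Proof.
by case=> _ _ _ A1 _; rewrite /lam /cov A1 metricZl eta1 mulr1.
Qed.

(** Pythagoras for e1 in the frame (xi, eta): the two curvatures are, up to
    sign, lam <xi, e1> and lam <eta, e1>. *)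
Lemma singular_value_curvatures p :
  lam p ^+ 2
    = g p (cov D xi xi p) (eta p) ^+ 2 + g p (cov D eta eta p) (xi p) ^+ 2.
Proof.
have [_ _ xe] := xi_eta_frame p.
rewrite (nabla_orthogonal D p _ eta_smooth xi_smooth (a := 0)); last first.
  by move=> q; rewrite metricC; case: (xi_eta_frame q).
rewrite /cov !nabla_xi !metricZl eta1 !mulr1.
have := metric_orthonormal (e1 p) (e1 p) (xi_eta_frame p).
rewrite e1e1 [g p (e1 p) (xi p)]metricC [g p (e1 p) (eta p)]metricC => h.
by rewrite -[LHS]mulr1 h; ring.
Qed.

(** Direct evaluation of K = <R(eta, xi) xi, eta>.  In the frame (eta, xi) the
    change to (e0, e1) only happens inside the differential of lam and the
    connection form, which are linear in the direction, whereas R(e0, e1) xi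
    would first have to be related to K. *)
Lemma gaussian_curvature_singular_value (K : M -> R) p :
  gaussian_curvature D K ->
  K p = (g p (xi p) (e1 p) * g p (eta p) (e0 p)
          - g p (xi p) (e0 p) * g p (eta p) (e1 p))
        * (tderiv lam p (e0 p) - lam p * g p (cov D e1 e1 p) (e0 p)).
Proof.
move=> HK; have [_ _ xe] := xi_eta_frame p.
have lam_smooth := singular_value_smooth.
pose a q := g q (xi q) (e1 q); pose b q := g q (eta q) (e1 q).
have a_smooth : smooth_fun a by exact: smooth_metric.
have b_smooth : smooth_fun b by exact: smooth_metric.
have cov_xi_xi : cov D xi xi = fun q => (lam q * a q) *: eta q.
  by apply/funext => q; exact: nabla_xi.
have cov_eta_xi : cov D eta xi = fun q => (lam q * b q) *: eta q.
  by apply/funext => q; exact: nabla_xi.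
have nabla_eta v (f : M -> R) : smooth_fun f ->
    g p (D p v (fun q => f q *: eta q)) (eta p) = tderiv f p v.
  move=> sf; rewrite nabla_leibniz // metric_addl !metricZl eta1 mulr1.
  by rewrite nabla_unit // mulr0 addr0.
have lie_eta_xi : lie eta xi p = D p (eta p) xi - D p (xi p) eta.
  by rewrite nabla_torsion.
rewrite (HK p eta xi) //; last first.
  by rewrite xi1 eta1 metricC xe expr2 mulr0 subr0 mulr1 oner_eq0.
rewrite /sectional xi1 eta1 [g p (eta p) (xi p)]metricC xe expr2 mulr0 subr0.
rewrite mulr1 divr1 /riemann !metricBl.
rewrite {1}/cov cov_xi_xi nabla_eta; last exact: smooth_funM.
rewrite {1}/cov cov_eta_xi nabla_eta; last exact: smooth_funM.
rewrite /cov nabla_xi metricZl eta1 mulr1 lie_eta_xi metricBl.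
rewrite !tderivM //.
have -> : tderiv a p (eta p) = _ :=
  nabla_metric D p (eta p) xi_smooth e1_smooth.
have -> : tderiv b p (xi p) = _ :=
  nabla_metric D p (xi p) eta_smooth e1_smooth.
(* The two remaining linear forms, d lam and the connection form of (e0, e1). *)
have dlam v : tderiv lam p v =
    g p v (e0 p) * tderiv lam p (e0 p) + g p v (e1 p) * tderiv lam p (e1 p).
  by rewrite {1}(orthonormal_expand v (e0_e1_frame p)) tderiv_lin.
have connection v w : g p w (D p v e1) = g p w (e0 p) *
    (g p v (e0 p) * g p (D p (e0 p) e1) (e0 p)
      + g p v (e1 p) * g p (D p (e1 p) e1) (e0 p)).
  rewrite (metric_orthonormal w _ (e0_e1_frame p)) nabla_unit // mulr0 addr0.
  rewrite {1}(orthonormal_expand v (e0_e1_frame p)) nabla_lin //.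
  by rewrite metric_addl !metricZl.
rewrite (dlam (eta p)) (dlam (xi p)) !connection /a /b; ring.
Qed.

End SurfaceFrames.

Theorem lemma3p1 (R : realType) (M : smoothManifold R 2)
    (g : riemannianMetric M) (D : leviCivita g) (K : M -> R)
    (xi eta e0 e1 : vfield M)
    (HK : gaussian_curvature D K)
    (xi_smooth : smooth_vfield xi) (eta_smooth : smooth_vfield eta)
    (e0_smooth : smooth_vfield e0) (e1_smooth : smooth_vfield e1)
    (xi_eta_frame : forall p : M, orthonormal_pair g p (xi p) (eta p))
    (e0_e1_frame : forall p : M, orthonormal_pair g p (e0 p) (e1 p))
    (cov_e0_xi : forall p : M, cov D e0 xi p = 0) :
  (exists lam : M -> R,
     smooth_fun lam /\
     forall p : M, singular_frame D xi p (e0 p) (e1 p) (eta p) (lam p)) /\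
  (forall lam : M -> R,
     (forall p : M, singular_frame D xi p (e0 p) (e1 p) (eta p) (lam p)) ->
     [/\ forall p : M, cov D e1 xi p = lam p *: eta p,
         forall p : M,
           let k := g p (cov D xi xi p) (eta p) in
           let kappa := g p (cov D eta eta p) (xi p) in
           lam p ^+ 2 = k ^+ 2 + kappa ^+ 2
       & forall p : M,
           let sigma := g p (cov D e1 e1 p) (e0 p) in
           let s := same_orientation xi eta e0 e1 p : nat in
           (-1) ^+ s * K p = tderiv lam p (e0 p) - lam p * sigma]).
Proof.
have frame := singular_value_frame xi_smooth xi_eta_frame e0_e1_frame cov_e0_xi.
split=> [|lam lamP].
  exists (singular_value D xi eta e1); split=> //.
  exact: singular_value_smooth.
have -> : lam = singular_value D xi eta e1.
  by apply/funext => p; exact: singular_frame_value (lamP p).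
split=> p; first exact: cov_e1_xi.
  exact: singular_value_curvatures.
move=> sigma s.
rewrite (gaussian_curvature_singular_value xi_smooth eta_smooth e1_smooth
  xi_eta_frame e0_e1_frame cov_e0_xi p HK) -/sigma.
have orient := same_orientationP (xi_eta_frame p) (e0_e1_frame p).
rewrite -[_ - _ * g p (eta p) (e1 p)]opprB orient /s.
by case: same_orientation; rewrite ?expr0 ?expr1 /=; ring.
Qed.
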